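(* For all integers $r,s \geq 0$, $\mathcal{B}_{r,s} \neq 0$, except exactly in the cases $(r,s) = (n,0)$ and $(r,s) = (0,n)$ with $n \geq 3$ odd, in which $\mathcal{B}_{r,s}=0$.
   Context: The Bernoulli numbers $\mathbf{B}_n$ are defined by $\frac{t}{e^t-1} = \sum_{n \geq 0} \mathbf{B}_n \frac{t^n}{n!}$ (so $\mathbf{B}_1 = -\tfrac12$). For integers $r,s \geq 0$ define $\mathcal{B}_{r,s} = \sum_{\nu=0}^{r} \binom{r}{\nu} \mathbf{B}_{s+\nu}$. *)

(* Defs.v *)
From mathcomp Require Import all_boot all_order all_algebra.
Set Implicit Arguments.
Unset Strict Implicit.
Unset Printing Implicit Defensive.
Import Order.TTheory GRing.Theory Num.Theory.
Local Open Scope ring_scope.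

(* A formal power series over rat is given by its coefficient sequence. *)
Definition fps := nat -> rat.

Definition fps_sub (f g : fps) : fps := fun n => f n - g n.

Definition fps_mul (f g : fps) : fps :=
  fun n => \sum_(i < n.+1) f i * g (n - i)%N.

Definition fps_one : fps := fun n => (n == 0%N)%:R.

Definition fps_X : fps := fun n => (n == 1%N)%:R.

(* [egf a] is \sum_n a_n t^n / n!. *)
Definition egf (a : nat -> rat) : fps := fun n => a n / n`!%:R.

Definition fps_exp : fps := egf (fun=> 1).

(* t / (e^t - 1) = egf B. The denominator is a nonzero element without constant
   term of the integral domain Q[[t]], so the quotient is expressed by clearing
   it; lemmas [is_bernoulli_exists] and [is_bernoulli_unique] below show that
   this determines B. *)
Definition is_bernoulli (B : nat -> rat) : Prop :=
  fps_mul (egf B) (fps_sub fps_exp fps_one) =1 fps_X.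

Definition bernoulli_sum (B : nat -> rat) (r s : nat) : rat :=
  \sum_(nu < r.+1) 'C(r, nu)%:R * B (s + nu)%N.

Lemma is_bernoulliE (B : nat -> rat) :
  is_bernoulli B <->
  forall n, B n / n`!%:R =
    (n == 0%N)%:R - \sum_(i < n) B i / i`!%:R / (n.+1 - i)`!%:R.
Proof.
have E n : fps_mul (egf B) (fps_sub fps_exp fps_one) n.+1 =
    \sum_(i < n) B i / i`!%:R / (n.+1 - i)`!%:R + B n / n`!%:R.
  rewrite /fps_mul big_ord_recr /= subnn big_ord_recr /=.
  rewrite /fps_sub /fps_exp /fps_one /egf subSnn /= !divr1 subrr mulr0 addr0.
  congr (_ + _); apply: eq_bigr => i _.
  by rewrite (@subSn _ n) ?(ltnW (ltn_ord i)) // subr0 div1r.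
split=> [hB n|hB [|n]].
- by have := hB n.+1; rewrite E /fps_X eqSS => <-; rewrite [X in X - _]addrC addrK.
- by rewrite /fps_mul big_ord1 /fps_sub /fps_exp /egf divr1 subrr mulr0.
- by rewrite E hB addrC subrK.
Qed.

Lemma is_bernoulli_unique (B B' : nat -> rat) :
  is_bernoulli B -> is_bernoulli B' -> B =1 B'.
Proof.
move=> /is_bernoulliE hB /is_bernoulliE hB' n.
elim/ltn_ind: n => n IH.
have nz : (n`!%:R : rat) != 0 by rewrite pnatr_eq0 -lt0n fact_gt0.
apply: (mulIf (invr_neq0 nz)); rewrite hB hB'; congr (_ - _).
by apply: eq_bigr => i _; rewrite IH.
Qed.

Lemma is_bernoulli_exists : exists B, is_bernoulli B.
Proof.
pose F n (s : seq rat) : rat :=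
  n`!%:R * ((n == 0%N)%:R - \sum_(i < n) s`_i / i`!%:R / (n.+1 - i)`!%:R).
pose S := fix S n := if n is m.+1 then rcons (S m) (F m (S m)) else [::].
have sizeS n : size (S n) = n by elim: n => //= n IH; rewrite size_rcons IH.
pose B n := (S n.+1)`_n.
have SB n i : (i < n)%N -> (S n)`_i = B i.
  elim: n => // n IH; rewrite ltnS leq_eqVlt => /orP[/eqP-> //|lt_in].
  by rewrite /= nth_rcons sizeS lt_in IH.
exists B; apply/is_bernoulliE => n.
have nz : (n`!%:R : rat) != 0 by rewrite pnatr_eq0 -lt0n fact_gt0.
rewrite {1}/B /= nth_rcons sizeS ltnn eqxx /F mulrC mulKf //.
by congr (_ - _); apply: eq_bigr => i _; rewrite SB.
Qed.

(* Main.v *)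
(** Umbrally, [X^n |-> B n] extends to a linear functional L on polynomials with
    L (p(X+1) - p(X)) = p'(0). Telescoping this on (X+k)^(n+1) for k < 3 gives
    the recurrence
      B_n = (0^n + 1 + 2^n) / 3
            - \sum_(i < n) C(n, i) 3^(n-i-1) / (n-i+1) (3 B_i),
    hence B_n = (1 + 2^n) / 3 modulo 3-integral rationals when n > 0. For s > 0
    the sum B_{r,s} is therefore (2^r + 2^s 3^r) / 3 modulo 3-integers, which is
    not 3-integral when r > 0; if r = 0 or s = 0 the sum reduces to +-B n, whose
    vanishing for odd n >= 3 follows because L ((-1-X)^n) satisfies the recurrence
    defining B n. *)
Require Import Defs.
From HB Require Import structures.
From mathcomp Require Import all_boot all_order all_algebra.
From mathcomp Require Import ring zify.
Set Implicit Arguments.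
Unset Strict Implicit.
Unset Printing Implicit Defensive.
Import Order.TTheory GRing.Theory Num.Theory.
Local Open Scope ring_scope.

(** * Binomial form of the Bernoulli recurrence *)

Lemma natr_neq0 (n : nat) : (0 < n)%N -> n%:R != 0 :> rat.
Proof. by rewrite pnatr_eq0 lt0n. Qed.

Lemma binR (n i : nat) : (i <= n)%N ->
  'C(n, i)%:R = n`!%:R / i`!%:R / (n - i)`!%:R :> rat.
Proof.
move=> le_in; rewrite -(bin_fact le_in) !natrM.
by field; rewrite !natr_neq0 ?fact_gt0.
Qed.

(** Scaling the coefficient of [t^(n+1)] by [(n+1)!] turns factorial quotients into binomials. The
    indicator is unaffected: it is supported where that factorial is [1! = 1]. *)
Lemma is_bernoulli_binP (B : nat -> rat) : is_bernoulli B <->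
  forall n, \sum_(i < n) 'C(n, i)%:R * B i = (n == 1%N)%:R.
Proof.
have E n : \sum_(i < n.+1) 'C(n.+1, i)%:R * B i =
    n.+1`!%:R * (\sum_(i < n) B i / i`!%:R / (n.+1 - i)`!%:R + B n / n`!%:R).
  have -> : B n / n`!%:R = B n / n`!%:R / (n.+1 - n)`!%:R.
    by rewrite subSnn divr1.
  rewrite -(big_ord_recr n (fun i : 'I_n.+1 => B i / i`!%:R / (n.+1 - i)`!%:R)).
  rewrite mulr_sumr; apply: eq_bigr => i _.
  by rewrite binR 1?ltnW // -!mulrA; congr (_ * _); ring.
split=> [/is_bernoulliE hB [|n]|hB]; first by rewrite big_ord0.
  by rewrite E hB [_ - _]addrC addrA subrr add0r eqSS; case: n => [|n]; rewrite ?mulr1 ?mulr0.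
apply/is_bernoulliE => n; have := hB n.+1; rewrite E eqSS => En.
have -> : (n == 0%N)%:R = (n == 0%N)%:R / n.+1`!%:R :> rat.
  by case: n {En} => [|n]; rewrite ?divr1 ?mul0r.
by rewrite -En mulrAC divff ?natr_neq0 ?fact_gt0 // mul1r addrC addKr.
Qed.

(** * The umbral functional *)

Definition umbral (B : nat -> rat) (p : {poly rat}) : rat :=
  \sum_(i < size p) p`_i * B i.

(** Padding with zero coefficients gives polynomials of different sizes a common summation range, as
    linearity requires. *)
Lemma umbralE (B : nat -> rat) (n : nat) (p : {poly rat}) : (size p <= n)%N ->
  umbral B p = \sum_(i < n) p`_i * B i.
Proof.
move=> le_pn; rewrite /umbral (big_ord_widen n (fun i => p`_i * B i)) //.
rewrite big_mkcond; apply: eq_bigr => i _.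
by case: ltnP => // le_pi; rewrite nth_default ?mul0r.
Qed.

Lemma umbral_is_linear (B : nat -> rat) : scalar (umbral B).
Proof.
move=> a p q; pose n := maxn (size p) (size q).
have le_n : (size (a *: p + q)%R <= n)%N.
  rewrite (leq_trans (size_polyD _ _)) // geq_max leq_maxr andbT.
  by rewrite (leq_trans (size_scale_leq _ _)) ?leq_maxl.
rewrite (umbralE _ le_n) (@umbralE B n p) ?leq_maxl // (@umbralE B n q) ?leq_maxr //.
rewrite mulr_sumr -big_split /=; apply: eq_bigr => i _.
by rewrite coefD coefZ mulrDl mulrA.
Qed.

HB.instance Definition _ (B : nat -> rat) :=
  GRing.isLinear.Build rat {poly rat} rat *%R (umbral B) (umbral_is_linear B).

Lemma umbralXn (B : nat -> rat) (n : nat) : umbral B 'X^n = B n.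
Proof.
rewrite /umbral size_polyXn big_ord_recr /= big1 ?coefXn ?eqxx ?mul1r ?add0r // => i _.
by rewrite coefXn ltn_eqF ?mul0r.
Qed.

Lemma umbral_mulXn_exp (B : nat -> rat) (c : rat) (n s : nat) :
  umbral B ('X^s * ('X + c%:P) ^+ n) =
  \sum_(i < n.+1) 'C(n, i)%:R * c ^+ (n - i) * B (s + i)%N.
Proof.
rewrite [_ + c%:P]addrC exprDn mulr_sumr linear_sum /=; apply: eq_bigr => i _.
rewrite -mulrnAl -polyC_exp -polyCMn mulrCA -exprD mul_polyC linearZ /=.
by rewrite umbralXn mulr_natl.
Qed.

Lemma umbral_exp (B : nat -> rat) (c : rat) (n : nat) :
  umbral B (('X + c%:P) ^+ n) =
  \sum_(i < n.+1) 'C(n, i)%:R * c ^+ (n - i) * B i.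
Proof. by rewrite -[in LHS](mul1r (_ ^+ n)) -(expr0 'X) umbral_mulXn_exp. Qed.

Lemma bernoulli_sumE (B : nat -> rat) (r s : nat) :
  bernoulli_sum B r s = umbral B ('X^s * ('X + 1) ^+ r).
Proof.
rewrite -polyC1 umbral_mulXn_exp; apply: eq_bigr => i _.
by rewrite expr1n mulr1.
Qed.

Lemma bernoulli_sum_r0 (B : nat -> rat) (hB : is_bernoulli B) (n : nat) :
  bernoulli_sum B n 0 = B n + (n == 1%N)%:R.
Proof.
rewrite /bernoulli_sum big_ord_recr /= binn mul1r addrC.
by move/is_bernoulli_binP: hB => <-.
Qed.

(** By linearity it suffices to treat [X^i], where the recurrence makes the difference 1 if [i = 1]
    and 0 otherwise, like the derivative of [X^i] at 0. *)
Lemma umbral_shift (B : nat -> rat) (hB : is_bernoulli B) (p : {poly rat}) :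
  umbral B (p \Po ('X + 1)) - umbral B p = p^`().[0].
Proof.
rewrite -[p]coefK poly_def !linear_sum /= horner_sum -sumrB; apply: eq_bigr => i _.
rewrite !linearZ /= hornerZ -mulrBr; congr (_ * _).
rewrite rmorphXn /= comp_polyX -[_ ^+ i]mul1r -(expr0 'X) -bernoulli_sumE umbralXn.
rewrite bernoulli_sum_r0 // addrC addKr derivXn hornerMn hornerXn expr0n.
by case: (nat_of_ord i) => [|[|k]]; rewrite ?mul0rn ?eqSS.
Qed.

Lemma umbral_expN (B : nat -> rat) (p : {poly rat}) (n : nat) :
  umbral B ((- p) ^+ n) = (-1) ^+ n * umbral B (p ^+ n).
Proof.
rewrite (exprNn p) -signr_odd -[in RHS]signr_odd.
by case: (odd n); rewrite ?expr0 ?expr1 ?mulN1r ?linearN ?mul1r.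
Qed.

(** * Vanishing at odd indices *)

Lemma bernoulli_odd (B : nat -> rat) (hB : is_bernoulli B) (n : nat) :
  (3 <= n)%N -> odd n -> B n = 0.
Proof.
pose B' n := umbral B ((- 'X - 1) ^+ n).
have B'E k : B' k = (-1) ^+ k * bernoulli_sum B k 0.
  by rewrite /B' -opprD umbral_expN bernoulli_sumE expr0 mul1r.
have hB' : is_bernoulli B'.
  apply/is_bernoulli_binP => k.
  (* Umbral expansion of [(1 + (-1 - X))^k = (-X)^k]. Removing the top term [B' k] cancels
     [(-1)^k B k] and leaves the indicator of [k = 1]. *)
  have: \sum_(i < k.+1) 'C(k, i)%:R * B' i = (-1) ^+ k * B k.
    have -> : (-1) ^+ k * B k = umbral B ((1 + (- 'X - 1)) ^+ k).
      by rewrite addrC subrK umbral_expN umbralXn.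
    rewrite exprDn linear_sum /=; apply: eq_bigr => i _.
    by rewrite expr1n mul1r linearMn /= mulr_natl.
  rewrite big_ord_recr /= binn mul1r => /(canRL (addrK _)) ->.
  rewrite B'E bernoulli_sum_r0 // -mulrBr opprD addrA subrr add0r.
  by case: k => [|[|k]]; rewrite ?mulr0 ?oppr0 ?mulr0 ?mulrNN ?mulr1.
(* For odd [n >= 3], [B' n = B n] reads [- B n = B n]. *)
move=> n3 odd_n; have := is_bernoulli_unique hB' hB n.
rewrite B'E bernoulli_sum_r0 // -signr_odd odd_n expr1 mulN1r.
have -> : (n == 1%N) = false by apply/eqP; lia.
by rewrite addr0 => /eqP; rewrite eq_sym -subr_eq0 opprK -mulr2n mulrn_eq0 => /eqP.
Qed.

(** * The recurrence with powers of 3 *)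

Lemma bernoulli_power_sum (B : nat -> rat) (hB : is_bernoulli B) (n : nat) :
  \sum_(i < n.+1) 'C(n.+1, i)%:R * 3 ^+ (n.+1 - i) * B i =
  n.+1%:R * (0 ^+ n + 1 + 2 ^+ n).
Proof.
have step (c : rat) : umbral B (('X + (c + 1)%:P) ^+ n.+1)
    - umbral B (('X + c%:P) ^+ n.+1) = n.+1%:R * c ^+ n.
  rewrite -[RHS](_ : (('X + c%:P) ^+ n.+1)^`().[0] = _); last first.
    rewrite deriv_exp derivD derivX derivC addr0 mul1r hornerMn horner_exp.
    by rewrite !hornerE mulr_natl.
  rewrite -(umbral_shift hB) rmorphXn /= comp_polyD comp_polyX comp_polyC.
  by rewrite polyCD polyC1 [c%:P + 1]addrC addrA.
(* The sum is the expansion of [(X+3)^(n+1)] without its top term [B n.+1], which is the image of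
   [X^(n+1)], the other end of the telescoping. *)
have := umbral_exp B 3 n.+1.
rewrite big_ord_recr /= binn subnn expr0 !mul1r => /(canLR (addrK _)) <-.
have := step 0; have := step 1; have := step 2.
have -> : 2 + 1 = 3 :> rat by [].
have -> : 1 + 1 = 2 :> rat by [].
rewrite add0r polyC0 addr0 umbralXn expr1n => E2 E1 E0.
by rewrite !mulrDr -E0 -E2 -[n.+1%:R * 1]E1; ring.
Qed.

(** The term [i = n] of the power sum is [3 (n+1) B n]; divide by its coefficient. One factor 3
    stays with [B i] because only [3 * B i] will be known to be 3-integral. *)
Lemma bernoulli_rec3 (B : nat -> rat) (hB : is_bernoulli B) (n : nat) :
  B n = (0 ^+ n + 1 + 2 ^+ n) / 3
    - \sum_(i < n) 'C(n, i)%:R * (3 ^+ (n - i).-1 / (n - i).+1%:R) * (3 * B i).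
Proof.
have nz : n.+1%:R != 0 :> rat by rewrite natr_neq0.
apply: (mulfI nz); apply: (mulfI (isT : 3 != 0 :> rat)).
rewrite !mulrBr [3 * (_ * (_ / 3))]mulrCA [3 * (_ / 3)]mulrC divfK //.
rewrite -(bernoulli_power_sum hB).
rewrite big_ord_recr /= subSnn binSn expr1 !mulr_sumr.
rewrite [X in _ = X - _]addrC -addrA -sumrB big1 ?addr0; first by ring.
move=> i _; have lt_in := ltn_ord i.
have <- : (n - i).-1.+2 = (n.+1 - i)%N by lia.
rewrite -[in (n - i).+1](@prednK (n - i)) ?subn_gt0 //.
have -> : 'C(n.+1, i)%:R = n.+1%:R / (n - i).-1.+2%:R * 'C(n, i)%:R :> rat.
  rewrite !binR 1?ltnW // 1?ltnW //.
  have -> : (n.+1 - i)%N = (n - i).-1.+2 by lia.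
  have -> : (n - i)%N = (n - i).-1.+1 by lia.
  rewrite /= !factS !natrM.
  by field; rewrite ?nat1r -?natrD !natr_neq0 ?fact_gt0.
by rewrite !exprS; ring.
Qed.

(** * Localization of the integers at 3 *)

Definition int3 (x : rat) : Prop :=
  exists2 d : nat, ~~ (3 %| d)%N & x * d%:R \is a Num.int.

Lemma int3_int (x : rat) : x \is a Num.int -> int3 x.
Proof. by exists 1%N; rewrite ?mulr1. Qed.

Lemma int3D (x y : rat) : int3 x -> int3 y -> int3 (x + y).
Proof.
move=> [d d3 hx] [e e3 hy]; exists (d * e)%N; first by rewrite Euclid_dvdM // negb_or d3.
by rewrite mulrDl natrM mulrA [y * _]mulrCA; apply: rpredD; apply: rpredM => //; apply: natr_int.
Qed.

Lemma int3M (x y : rat) : int3 x -> int3 y -> int3 (x * y).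
Proof.
move=> [d d3 hx] [e e3 hy]; exists (d * e)%N; first by rewrite Euclid_dvdM // negb_or d3.
by rewrite natrM mulrACA rpredM.
Qed.

Lemma int3N (x : rat) : int3 x -> int3 (- x).
Proof. by case=> d d3 hx; exists d; rewrite ?mulNr ?rpredN. Qed.

Lemma int3_sum (I : Type) (s : seq I) (P : pred I) (F : I -> rat) :
  (forall i, P i -> int3 (F i)) -> int3 (\sum_(i <- s | P i) F i).
Proof. by move=> hF; apply: big_ind => //; [apply: int3_int | apply: int3D]. Qed.

Lemma int3_div3 (n : nat) : int3 (n%:R / 3) -> (3 %| n)%N.
Proof.
case=> d d3 /intrP[z hz].
have nd : (n * d)%:Z = z * 3.
  apply: (@intr_inj rat); rewrite intrM -hz -[(n * d)%:Z%:~R]/((n * d)%:R) natrM.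
  by field.
have: (3 %| n * d)%N by lia.
by rewrite Euclid_dvdM // (negbTE d3) orbF.
Qed.

(** Write [m+1 = u 3^v] with [u] prime to 3. Since [3^v <= m+1 < 3^m], the numerator absorbs [3^v]
    and [u] serves as denominator. *)
Lemma int3_expr_div (m : nat) : (0 < m)%N -> int3 (3 ^+ m.-1 / m.+1%:R).
Proof.
move=> m_gt0; have [u u3 Em] := pfactor_coprime (isT : prime 3) (ltn0Sn m).
set v := logn 3 m.+1 in Em.
have u_gt0 : (0 < u)%N by case: u u3 Em.
have lt_vm : (v < m)%N.
  rewrite -(@ltn_exp2l 3) // (@leq_ltn_trans m.+1) //.
    by rewrite Em leq_pmull.
  elim: m m_gt0 {Em v u u3 u_gt0} => // -[//|m] IH _.
  by rewrite expnS; have := IH isT; lia.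
exists u; first by rewrite -prime_coprime.
have -> : m.-1 = (m.-1 - v + v)%N by lia.
rewrite Em natrM natrX exprD.
suff -> : 3 ^+ (m.-1 - v) * 3 ^+ v / (u%:R * 3 ^+ v) * u%:R = 3 ^+ (m.-1 - v) :> rat.
  by rewrite rpredX.
by field; rewrite natr_neq0 // expf_neq0.
Qed.

(** The von Staudt-Clausen congruence at 3. The [0 ^+ n] term makes the residue 0 at [n = 0], where
    [B 0 = 1]. *)
Lemma bernoulli_mod3 (B : nat -> rat) (hB : is_bernoulli B) (n : nat) :
  int3 (B n - (1 + 2 ^+ n - 2 * 0 ^+ n) / 3).
Proof.
elim/ltn_ind: n => n IH.
rewrite [B n]bernoulli_rec3 // addrAC -mulrBl.
apply: int3D.
  rewrite (_ : _ / 3 = 0 ^+ n); last by field.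
  by apply: int3_int; rewrite rpredX.
apply/int3N/int3_sum => i _; apply: int3M; first apply: int3M.
- by apply: int3_int; rewrite natr_int.
- by apply: int3_expr_div; rewrite subn_gt0.
(* By induction [B i] is a 3-integer plus an integer over 3, so [3 * B i] is 3-integral. *)
rewrite -[B i](subrK ((1 + 2 ^+ i - 2 * 0 ^+ i) / 3)) mulrDr; apply: int3D.
  by apply: int3M (IH i (ltn_ord i)); apply: int3_int.
by rewrite mulrC divfK //; apply: int3_int; rewrite !(rpredB, rpredD, rpredM, rpredX).
Qed.

(** For even [n], [2^n] is a power of 4, so [1 + 2^n] is 2 modulo 3 and the residue is not
    3-integral. *)
Lemma bernoulli_neq0 (B : nat -> rat) (hB : is_bernoulli B) (n : nat) :
  (1 < n)%N -> ~~ odd n -> B n <> 0.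
Proof.
move=> n1 even_n Bn0; have := int3N (bernoulli_mod3 hB n).
rewrite Bn0 sub0r opprK expr0n [n == _]gtn_eqF 1?ltnW // mulr0 subr0.
rewrite -natrX nat1r => /int3_div3; rewrite /dvdn -add1n -modnDmr.
rewrite -(odd_double_half n) (negbTE even_n) -muln2 mulnC expnM -modnXm.
by rewrite exp1n.
Qed.

(** As [s > 0], no index [s + i] is 0, so each term has residue [(1 + 2^(s+i)) / 3]; the binomial
    theorem for [(1+1)^r] and [(1+2)^r] sums them. *)
Lemma bernoulli_sum_mod3 (B : nat -> rat) (hB : is_bernoulli B) (r s : nat) :
  (0 < s)%N -> int3 (bernoulli_sum B r s - (2 ^ s * 3 ^ r + 2 ^ r)%:R / 3).
Proof.
move=> s_gt0.
have -> : (2 ^ s * 3 ^ r + 2 ^ r)%:R =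
    \sum_(i < r.+1) 'C(r, i)%:R * (1 + 2 ^+ (s + i)) :> rat.
  have E c : (1 + c) ^+ r = \sum_(i < r.+1) 'C(r, i)%:R * c ^+ i :> rat.
    by rewrite exprDn; apply: eq_bigr => i _; rewrite expr1n mul1r mulr_natl.
  rewrite natrD natrM !natrX (E 2) -[X in _ + X ^+ r](_ : 1 + 1 = 2) // E.
  rewrite mulr_sumr -big_split /=; apply: eq_bigr => i _.
  by rewrite expr1n exprD; ring.
rewrite /bernoulli_sum mulr_suml -sumrB; apply: int3_sum => i _.
rewrite -mulrA -mulrBr; apply: int3M; first by apply: int3_int; rewrite natr_int.
have := bernoulli_mod3 hB (s + i).
by rewrite expr0n addn_eq0 [s == _]gtn_eqF // mulr0 subr0.
Qed.

(** For [r > 0], 3 divides [2^s 3^r] but not [2^r]. *)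
Lemma bernoulli_sum_neq0 (B : nat -> rat) (hB : is_bernoulli B) (r s : nat) :
  (0 < r)%N -> (0 < s)%N -> bernoulli_sum B r s <> 0.
Proof.
move=> r_gt0 s_gt0 E; have := int3N (bernoulli_sum_mod3 hB r s_gt0).
rewrite E sub0r opprK => /int3_div3.
rewrite dvdn_addr; last by rewrite dvdn_mull // dvdn_exp.
by rewrite Euclid_dvdX.
Qed.

(** * Classification of the zeros *)

Lemma bernoulli0 (B : nat -> rat) (hB : is_bernoulli B) : B 0%N = 1.
Proof.
by move/is_bernoulli_binP: hB => /(_ 1%N); rewrite big_ord1 mul1r.
Qed.

Lemma bernoulli1 (B : nat -> rat) (hB : is_bernoulli B) : B 1%N = - 2^-1.
Proof.
move/is_bernoulli_binP: (hB) => /(_ 2%N).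
rewrite big_ord_recl big_ord1 /= bernoulli0 // /bump /= !mul1r => E.
by apply: (mulfI (isT : 2 != 0 :> rat)); apply/eqP; rewrite mulrN divff // -addr_eq0 addrC E.
Qed.

Lemma bernoulli_eq0 (B : nat -> rat) (hB : is_bernoulli B) (n : nat) :
  B n = 0 <-> (3 <= n)%N /\ odd n.
Proof.
split=> [Bn0|[]]; last exact: bernoulli_odd.
case: n Bn0 => [|[|n]] Bn0.
- by move/eqP: Bn0; rewrite bernoulli0.
- by move/eqP: Bn0; rewrite bernoulli1.
have [odd_n|even_n] := boolP (odd n.+2); last by case: (bernoulli_neq0 hB _ even_n Bn0).
by split=> //; case: n odd_n {Bn0}.
Qed.

Theorem theorem1p2 (B : nat -> rat) (hB : is_bernoulli B) (r s : nat) :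
  bernoulli_sum B r s = 0 <->
  exists n : nat, [/\ (3 <= n)%N, odd n & (r, s) = (n, 0%N) \/ (r, s) = (0%N, n)].
Proof.
have E0s n : bernoulli_sum B 0 n = B n by rewrite /bernoulli_sum big_ord1 addn0 mul1r.
(* The two values differ only at [n = 1], where they are [1/2] and [-1/2], both nonzero. *)
have Er0 n : bernoulli_sum B n 0 = 0 <-> B n = 0.
  rewrite bernoulli_sum_r0 //; case: n => [|[|n]]; rewrite ?addr0 //.
  by rewrite (bernoulli1 hB); split=> /eqP.
split=> [|[n [n3 odd_n]]]; last first.
  have Bn0 : B n = 0 by apply/bernoulli_eq0.
  by case=> [[-> ->]|[-> ->]]; [apply/Er0 | rewrite E0s].
case: (posnP r) => [->|r_gt0].
  by rewrite E0s => /(bernoulli_eq0 hB)[n3 odd_n]; exists s; split=> //; right.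
case: (posnP s) => [->|s_gt0 /(bernoulli_sum_neq0 hB r_gt0 s_gt0)//].
by move/Er0/(bernoulli_eq0 hB) => [n3 odd_n]; exists r; split=> //; left.
Qed.
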